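(* Let $G$ be a $\sigma$-compact locally compact metrizable group, $\Gamma\subset G$ a discrete subgroup, $X=G/\Gamma$, and let $\mu$ be a Borel probability measure on $G$. If the random walk on $X$ given by $\mu$ is $\psi$-irreducible, then $\mu$ is spread out and $\psi\ll[m_X]$. Conversely, if $\mu$ is spread out and $\Gamma$-adapted, then the random walk on $X$ given by $\mu$ is $\psi$-irreducible with $[m_X]\sim\psi$.
   Context: The random walk on $X$ given by $\mu$ is the Markov chain $(\Phi_n)_{n\ge 0}$ with transition kernel $P(x,\cdot)=\mu*\delta_x$, so $P^n(x,\cdot)=\mu^{*n}*\delta_x$; $\mathbb{P}_x$ is the law of the chain started at $x$. For Borel $A\subset X$, $L(x,A)=\mathbb{P}_x[\Phi_n\in A\text{ for some }n\ge1]$. A $\sigma$-finite measure $\varphi$ on $X$ is an irreducibility measure if $\varphi(A)>0$ implies $L(x,A)>0$ for all $x\in X$. The chain is $\psi$-irreducible if it admits a non-trivial irreducibility measure; then there is a maximal irreducibility measure (one with respect to which every irreducibility measure is absolutely continuous), unique up to equivalence, and $\psi$ always denotes such a maximal irreducibility measure. $\mu$ is spread out if for some $n_0\in\mathbb{N}$ the convolution power $\mu^{*n_0}$ is not singular with respect to Haar measure on $G$. $\mu$ is adapted if the closed subgroup generated by $\operatorname{supp}(\mu)$ is $G$. Let $\mathcal{S}$ be the closed subsemigroup of $G$ generated by $\operatorname{supp}(\mu)$. $\mu$ is $\Gamma$-adapted if $\mu$ is adapted and $\mathcal{S}\Gamma_g=\{s\gamma: s\in\mathcal{S},\gamma\in\Gamma_g\}=G$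 for all $g\in G$, where $\Gamma_g=g\Gamma g^{-1}$. Haar measure class $[m_X]$: let $\Delta$ be the modular character of $G$. For every continuous character $\chi\colon G\to\mathbb{R}_{>0}$ extending $\Delta|_\Gamma$ there is a non-trivial Radon measure $m_{X,\chi}$ on $X$, unique up to scalars, with $g_*m_{X,\chi}=\chi(g)m_{X,\chi}$ for all $g\in G$ (the choice $\chi=\Delta$ is always possible). All these $m_{X,\chi}$ lie in one measure class, denoted $[m_X]$; $m_{X,\Delta}$ can be identified with the restriction of a right Haar measure of $G$ to a fundamental domain for $\Gamma$. $\psi\ll[m_X]$ means $\psi$ is absolutely continuous with respect to this class and $\psi\sim[m_X]$ means $\psi$ belongs to it. *)

(* Defs.v *)
From HB Require Import structures.
From mathcomp Require Import all_boot all_order all_algebra generic_quotient.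
From mathcomp Require Import all_classical all_reals all_analysis.

Set Implicit Arguments.
Unset Strict Implicit.
Unset Printing Implicit Defensive.

Import Order.TTheory GRing.Theory Num.Theory.
Import numFieldNormedType.Exports.

Local Open Scope classical_set_scope.
Local Open Scope ring_scope.

HB.mixin Record isTopologicalGroup G of Topological G & monoid.Group G := {
  mulg_continuous : continuous (fun x : G * G => (x.1 * x.2)%g);
  invg_continuous : continuous (fun x : G => (x^-1)%g)
}.

(* The point of a pointed type is required by the measurable structures of the
   library only; it plays no mathematical role. *)
#[short(type="topologicalGroupType")]
HB.structure Definition TopologicalGroup :=
  {G of PointedTopological G & monoid.Group G & isTopologicalGroup G}.

Notation borel T := (g_sigma_algebraType (@open T)).

Section topology.
Variables (R : realType) (T : topologicalType).

Definition sigma_compact : Prop :=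
  exists2 K : (set T)^nat, forall n, compact (K n) & \bigcup_n K n = setT.

Definition metrizable : Prop := exists d : T -> T -> R,
  [/\ forall x y, d x y = 0 <-> x = y,
      forall x y, d x y = d y x,
      forall x y z, d x z <= d x y + d y z &
      forall x (A : set T), nbhs x A <->
        exists2 e : R, 0 < e & [set y | d x y < e] `<=` A].

Definition discrete_subset (A : set T) : Prop := A `<=` isolated A.

End topology.

(* On the spaces considered here (locally compact, sigma-compact, metrizable)
   the regularity clauses follow from finiteness on compact sets. *)
Definition radon (R : realType) (T : ptopologicalType)
    (m : {measure set (borel T) -> \bar R}) : Prop :=
  [/\ forall K : set T, compact K -> (m K < +oo)%E,
      forall A : set (borel T), measurable A ->
        m A = ereal_inf [set m U | U in [set U : set T | open U /\ A `<=` U]] &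
      forall U : set T, open U ->
        m U = ereal_sup [set m K | K in [set K : set T | compact K /\ K `<=` U]]].

Definition mutually_singular (R : realType) d (T : measurableType d)
    (m1 m2 : set T -> \bar R) : Prop :=
  exists A : set T, [/\ measurable A, m1 A = 0%E & m2 (~` A) = 0%E].

Section homogeneous_space.
Variables (G : topologicalGroupType) (Gamma : groupClosed G).

Definition coset_rel : rel G := fun x y => (x^-1 * y)%g \in Gamma.

Lemma coset_rel_refl : reflexive coset_rel.
Proof. by move=> x; rewrite /coset_rel mulVg gpred1. Qed.

Lemma coset_rel_sym : symmetric coset_rel.
Proof. by move=> x y; rewrite /coset_rel -gpredV invgM invgK. Qed.

Lemma coset_rel_trans : transitive coset_rel.
Proof.
move=> y x z; rewrite /coset_rel => xy yz.
by rewrite -(mulVKg y z) mulgA gpredM.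
Qed.

Canonical coset_equiv :=
  EquivRel coset_rel coset_rel_refl coset_rel_sym coset_rel_trans.

(* G / Gamma, the space of left cosets x Gamma *)
Definition homogeneous_space : Type :=
  quotient_topology {eq_quot coset_equiv}%qT.

HB.instance Definition _ := Quotient.on homogeneous_space.
HB.instance Definition _ := PointedTopological.on homogeneous_space.

Definition gact (g : G) (x : homogeneous_space) : homogeneous_space :=
  (\pi_homogeneous_space (g * repr x)%g)%qT.

Lemma gactE (g h : G) :
  gact g (\pi_homogeneous_space h)%qT = (\pi_homogeneous_space (g * h)%g)%qT.
Proof.
apply/eqmodP; rewrite /= /coset_rel invgM -mulgA mulKg.
by have /eqmodP := reprK (\pi_homogeneous_space h)%qT.
Qed.

End homogeneous_space.

Section convolution.
Variables (R : realType) (G : topologicalGroupType) (Gamma : groupClosed G).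
Local Notation X := (homogeneous_space Gamma).
Local Open Scope ereal_scope.

Definition conv (mu nu : set (borel G) -> \bar R) : set (borel G) -> \bar R :=
  pushforward (mu \x nu)
    (fun p : borel G * borel G => ((p.1 : G) * (p.2 : G))%g : borel G).

Definition conv_act (mu : set (borel G) -> \bar R)
    (nu : set (borel X) -> \bar R) : set (borel X) -> \bar R :=
  pushforward (mu \x nu)
    (fun p : borel G * borel X => gact p.1 p.2 : borel X).

(* n-fold convolution power; it is the unit mass at 1 for n = 0 *)
Definition conv_pow (mu : set (borel G) -> \bar R) (n : nat) :
    set (borel G) -> \bar R :=
  iter n (conv mu) (\d_(1%g : borel G))%R.

Definition rw_kernel (mu : set (borel G) -> \bar R) (x : borel X) :
    set (borel X) -> \bar R :=
  conv_act mu (\d_x)%R.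

End convolution.

Section markov_chain.
Variables (R : realType) (d : measure_display) (X : measurableType d).
Local Open Scope ereal_scope.

Definition cylinders : set (set (nat -> X)) :=
  [set C | exists n (A : set X), measurable A /\ C = [set w | A (w n)]].

(* trajectories, with the product sigma-algebra *)
Definition path_space := g_sigma_algebraType cylinders.

(* The coordinate process on the path space is, under Pr, a Markov chain with
   transition kernel P started at x. Such a Pr is unique, and it exists for every
   Markov kernel by the Ionescu-Tulcea theorem. *)
Definition markov_chain_law (P : X -> set X -> \bar R) (x : X)
    (Pr : probability path_space R) : Prop :=
  (forall A : set X, measurable A -> Pr [set w : nat -> X | A (w 0%N)] = \d_x A) /\
  (forall (n : nat) (A : (set X)^nat) (B : set X),
    (forall i, measurable (A i)) -> measurable B ->
    let past : set path_space :=
      [set w : nat -> X | forall i, (i <= n)%N -> A i (w i)] in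
    Pr (past `&` [set w : nat -> X | B (w n.+1)]) =
      \int[Pr]_(w in past) P ((w : nat -> X) n) B).

Variable Pr : X -> probability path_space R.

Definition hitting_prob (x : X) (A : set X) : \bar R :=
  Pr x [set w : nat -> X | exists2 n, (1 <= n)%N & A (w n)].

Definition irreducibility_measure (phi : {sigma_finite_measure set X -> \bar R})
  : Prop :=
  forall A : set X, measurable A -> 0 < phi A -> forall x, 0 < hitting_prob x A.

Definition psi_irreducible : Prop :=
  exists phi : {sigma_finite_measure set X -> \bar R},
    irreducibility_measure phi /\ phi setT != 0.

Definition maximal_irreducibility_measure
    (psi : {sigma_finite_measure set X -> \bar R}) : Prop :=
  irreducibility_measure psi /\
  forall phi : {sigma_finite_measure set X -> \bar R},
    irreducibility_measure phi -> phi `<< psi.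

End markov_chain.

Section haar.
Variables (R : realType) (G : topologicalGroupType) (Gamma : groupClosed G).
Local Notation X := (homogeneous_space Gamma).

Definition left_haar (m : {measure set (borel G) -> \bar R}) : Prop :=
  [/\ radon m, m setT != 0%E &
      forall (g : G) (A : set (borel G)), measurable A ->
        m [set (g * a)%g | a in (A : set G)] = m A].

Definition continuous_character (chi : G -> R) : Prop :=
  [/\ forall g, 0 < chi g,
      forall g h, chi (g * h)%g = chi g * chi h &
      continuous chi].

(* m is a left Haar measure. With this normalization of Delta, a right Haar
   measure r satisfies g_* r = Delta(g) r, where (g_* r)(A) = r(g^-1 A). *)
Definition modular_character (m : {measure set (borel G) -> \bar R})
    (Delta : G -> R) : Prop :=
  continuous_character Delta /\
  forall (g : G) (A : set (borel G)), measurable A ->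
    m [set (a * g)%g | a in (A : set G)] = ((Delta g)%:E * m A)%E.

Definition extends_modular_character (Delta chi : G -> R) : Prop :=
  continuous_character chi /\ forall g, g \in Gamma -> chi g = Delta g.

Definition chi_haar (chi : G -> R) (m : {measure set (borel X) -> \bar R}) : Prop :=
  [/\ radon m, m setT != 0%E &
      forall (g : G) (A : set (borel X)), measurable A ->
        pushforward m (fun x : borel X => gact g x : borel X) A =
        ((chi g)%:E * m A)%E].

End haar.

Section adapted.
Variables (R : realType) (G : topologicalGroupType) (Gamma : groupClosed G).
Variable mu : probability (borel G) R.

Definition support : set G :=
  [set g | forall U : set G, open U -> U g -> (0 < mu U)%E].

Definition closed_subgroup_gen (A : set G) : set G :=
  smallest [set H : set G | closed H /\ group_closed (mem H)] A.

Definition closed_subsemigroup_gen (A : set G) : set G :=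
  smallest [set S : set G | closed S /\ mulg_closed (mem S)] A.

Definition spread_out (m : {measure set (borel G) -> \bar R}) : Prop :=
  exists2 n, (1 <= n)%N & ~ mutually_singular (conv_pow mu n) m.

Definition adapted : Prop := closed_subgroup_gen support = setT.

Definition conj_subgroup (g : G) : set G :=
  [set (g * c * g^-1)%g | c in [set c | c \in Gamma]].

Definition Gamma_adapted : Prop :=
  adapted /\
  forall g : G,
    [set (s * c)%g | s in closed_subsemigroup_gen support & c in conj_subgroup g]
    = setT.

End adapted.

(* Main.v *)
From HB Require Import structures.
Require Import Defs.
From mathcomp Require Import all_boot all_order all_algebra generic_quotient.
From mathcomp Require Import all_classical all_reals all_analysis.
From mathcomp Require Import measurable_realfun lebesgue_integral_fubini.
From mathcomp Require Import lra.

Set Implicit Arguments.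
Unset Strict Implicit.
Unset Printing Implicit Defensive.

Import Order.TTheory GRing.Theory Num.Theory.
Import numFieldNormedType.Exports.
Local Open Scope classical_set_scope.
Local Open Scope ring_scope.

(** Write [nu n] for the n-th convolution power of [mu].  By the Markov property
    the n-th marginal of the walk started at [x] is the image of [nu n] under
    [g |-> g x] ([marginalE]), so a Borel set [A] is hit with positive
    probability from [x] if and only if some [nu n], n >= 1, charges
    [{g | g x \in A}] ([hitting_prob_gt0]).  From then on only null sets matter,
    and the one tool is Tonelli's theorem in the form [null_sections]: a Borel
    subset of a product has almost all horizontal sections null if and only if
    it has almost all vertical sections null.

    Necessity.  The measure [mX] is quasi-invariant, so if [mX A = 0] then for
    all [g] the set of [x] with [g x \in A] is [mX]-null; exchanging sections,
    for almost every [x] no [nu n] charges [{g | g x \in A}].  A single such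
    [x], from which [A] is not reached, shows that irreducibility measures
    vanish on [A] ([irreducibility_measure_null]).  If no convolution power had
    an absolutely continuous part, there would be one Haar-null set [N]
    carrying all of them.  As [Gamma] is countable, [N Gamma] is Haar-null,
    hence the image of [N] in the quotient is [mX]-null ([null_proj_image]);
    but the walk started at the base point almost surely stays in that image
    from time 1 on, so every irreducibility measure would be zero
    ([irreducible_spread_out]).

    Sufficiency.  It is enough that [mX] itself is an irreducibility measure.
    If [nu n] is not singular, Haar measure restricted to some non-null set
    [D] is absolutely continuous with respect to [nu n]
    ([not_singular_dominates]), and a Steinhaus argument shows that
    [nu (n + n)] then dominates Haar measure on a non-empty open set [U]
    ([dominated_on_open]).  Every neighbourhood of a point of the closed
    semigroup [S] generated by the support is charged by some [nu k]
    ([semigroup_charged]).  Let [A] be the preimage in [G] of a non-null subset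
    of the quotient and let [x = h Gamma].  The identity
    [S (h Gamma h^-1) = G] lets one move [U] by a product [s h c], with [s] in
    [S] and [c] in [Gamma], onto a point near which [A] has positive Haar
    measure; as [A] is invariant under [Gamma] on the right, [U s h] meets [A]
    in positive measure, and so do the sets [U s' h] for [s'] near [s].
    Starting from [h Gamma], a first stretch of the walk near [s] followed by
    a second one spread over [U] therefore reaches [A] with positive
    probability ([spread_out_charges]). *)

(** * Countable bases and Borel sets of products *)

(** An enumerated form of second countability; the enumeration is what the
    countable unions below are indexed by. *)
Definition countable_base (T : topologicalType) (B : (set T)^nat) : Prop :=
  (forall n, open (B n)) /\
  forall (x : T) (U : set T), open U -> U x -> exists2 n, B n x & B n `<=` U.

Lemma metrizable_hausdorff (R : realType) (T : topologicalType) :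
  metrizable R T -> hausdorff_space T.
Proof.
case=> d [d0 dC dT dN] x y xy; apply/d0/eqP; rewrite eq_le; apply/andP; split.
  rewrite leNgt; apply/negP => dxy.
  have e0 : 0 < d x y / 2 by rewrite divr_gt0.
  have bx z : nbhs z [set t | d z t < d x y / 2] by apply/dN; exists (d x y / 2).
  have [z [/= xz yz]] := xy _ _ (bx x) (bx y).
  by have := dT x z y; rewrite (dC z y) leNgt [ltRHS](splitr (d x y)) ltrD.
have := dT x y x; rewrite (dC y x) (_ : d x x = 0); last exact/d0.
by rewrite -mulr2n pmulrn_lge0.
Qed.

(** For each [n] and [m] finitely many balls of radius [1 / (m + 1)] cover the
    n-th compact set; all these balls together form a base. *)
Lemma metrizable_countable_base (R : realType) (T : ptopologicalType) :
  sigma_compact T -> metrizable R T -> exists B : (set T)^nat, countable_base B.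
Proof.
case=> K cK KT [d [d0 dC dT dN]].
pose ball z (e : R) := [set t | d z t < e].
have ball_open z e : open (ball z e).
  rewrite openE => t /= zt; apply/dN; exists (e - d z t); first by rewrite subr_gt0.
  by move=> u /=; rewrite ltrBrDl; exact: le_lt_trans.
have /choice[F FK] (nm : nat * nat) : exists F : seq T,
    forall z, K nm.1 z -> exists2 c, c \in F & ball c nm.2.+1%:R^-1 z.
  have := cK nm.1; rewrite compact_cover.
  move=> /(_ T setT (fun c => ball c nm.2.+1%:R^-1))[//|z _|D _ DK].
    exists z => //=; rewrite /ball /= (_ : d z z = 0); last exact/d0.
    by rewrite invr_gt0 ltr0n.
  exists (finmap.enum_fset D) => z /DK[c /= cD cz]; by exists c.
pose B k := if unpickle k is Some (n, m, i) then
   ball (nth point (F (n, m)) i) m.+1%:R^-1 else set0.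
exists B; split=> [k|x U oU Ux].
  by rewrite /B; case: unpickle => [[[n m] i]|] //; exact: open0.
have /dN[e e0 eU] : nbhs x U by exact: open_nbhs_nbhs.
have [m me] : exists m : nat, m.+1%:R^-1 < e / 2.
  have /ltr_add_invr[k] : 0 < e / 2 by rewrite divr_gt0.
  by rewrite add0r; exists k.
have [n _ Kx] : (\bigcup_n K n) x by rewrite KT.
have [c cF cx] := FK (n, m) _ Kx.
exists (pickle (n, m, index c (F (n, m)))).
  by rewrite /B pickleK nth_index.
rewrite /B pickleK nth_index// => y /= cy; apply: eU => /=.
(* both [x] and [y] lie within [e / 2] of the centre [c] *)
apply: le_lt_trans (dT x c y) _; rewrite (splitr e) dC ltrD//.
  exact: lt_trans cx me.
exact: lt_trans cy me.
Qed.

Section borel.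
Implicit Types T : ptopologicalType.

Lemma open_borel T (U : set T) : open U -> measurable (U : set (borel T)).
Proof. by move=> oU; exact: sub_sigma_algebra. Qed.

Lemma closed_borel T (U : set T) : closed U -> measurable (U : set (borel T)).
Proof.
by move=> cU; rewrite -(setCK U); apply: measurableC; apply: open_borel; rewrite openC.
Qed.

Lemma borel_measurable_fun d T (S : measurableType d) (f : S -> T) :
  (forall U, open U -> measurable (f @^-1` U)) ->
  measurable_fun setT (f : S -> borel T).
Proof.
move=> fU; apply: (@measurability _ _ S (borel T) setT f (@open T)) => // _ [U oU <-].
by rewrite setTI; exact: fU.
Qed.

Lemma continuous_borel (S : ptopologicalType) T (f : S -> T) :
  continuous f -> measurable_fun setT (f : borel S -> borel T).
Proof.
move=> /continuousP cf; apply: (@borel_measurable_fun _ _ (borel S)) => U /cf.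
exact: open_borel.
Qed.

Variables (S1 S2 : ptopologicalType) (B1 : (set S1)^nat) (B2 : (set S2)^nat).
Hypotheses (bB1 : countable_base B1) (bB2 : countable_base B2).

(** The sigma-algebra on the product is generated by measurable rectangles; it
    contains the open sets because these are countable unions of rectangles
    of basic open sets. *)
Lemma open_product_borel (U : set (S1 * S2)) :
  open U -> measurable (U : set (borel S1 * borel S2)).
Proof.
move=> oU; have -> : U = \bigcup_i \bigcup_(j in [set j | B1 i `*` B2 j `<=` U])
    (B1 i `*` B2 j).
  rewrite eqEsubset; split=> [[x y] Uxy|z [i _ [j]]]; last exact.
  have /= [[V W] [/= xV yW] VW] : nbhs (x, y) U by exact: open_nbhs_nbhs.
  move: xV yW; rewrite !nbhsE => -[V' [oV V'x] VV] [W' [oW W'y] WW].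
  have [i ix iV] := bB1.2 _ _ oV V'x; have [j jy jW] := bB2.2 _ _ oW W'y.
  exists i => //; exists j => // -[u v] /= [/iV/VV uV /jW/WW vW].
  by apply: VW; split.
apply: bigcup_measurable => i _; apply: bigcup_measurable => j _.
by apply: measurableX;
  [exact: open_borel (bB1.1 i)|exact: open_borel (bB2.1 j)].
Qed.

Lemma continuous_borel2 T (f : S1 * S2 -> T) : continuous f ->
  measurable_fun setT (f : borel S1 * borel S2 -> borel T).
Proof.
move=> /continuousP cf.
apply: (@borel_measurable_fun _ _ (borel S1 * borel S2)%type) => U /cf.
exact: open_product_borel.
Qed.

End borel.

(** * Null sets of products *)

(** A measure that is only known to be sigma-finite through a hypothesis is
    copied under this name, so that the theorems on sigma-finite measures
    apply to it. *)
Section sigma_finite_copy.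
Context d (T : measurableType d) (R : realType).
Variables (m : {measure set T -> \bar R}) (mfin : sigma_finite setT m).

Definition sfmeasure of sigma_finite setT m : set T -> \bar R := m.

HB.instance Definition _ := Measure.copy (sfmeasure mfin) m.
HB.instance Definition _ := Measure_isSigmaFinite.Build _ _ _ (sfmeasure mfin) mfin.

End sigma_finite_copy.

Section ae.
Context d (T1 : measurableType d) (R : realType).
Local Open Scope ereal_scope.

Lemma ae_exists (m : {measure set T1 -> \bar R}) (P : T1 -> Prop) :
  m setT != 0 -> (\forall x \ae m, P x) -> exists x, P x.
Proof.
move=> mT [A [mA mA0 PA]]; apply: contrapT => /forallNP nP.
by move/eqP: mT; apply; rewrite -mA0; congr (m _); apply/seteqP; split=> // x _;
  apply: PA; exact: nP.
Qed.

Lemma ge0_integral_eq0P (m : {measure set T1 -> \bar R}) (f : T1 -> \bar R) :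
  measurable_fun [set: T1] f -> (forall x, 0 <= f x) ->
  \int[m]_x f x = 0 <-> \forall x \ae m, f x = 0.
Proof.
move=> mf f0; have := @ae_eq_integral_abs _ _ _ m setT measurableT f mf.
under eq_integral do rewrite gee0_abs//.
move=> ->; split; apply: filterS => x; first exact.
by move=> fx _.
Qed.

End ae.

Section null_sections.
Context d1 d2 (T1 : measurableType d1) (T2 : measurableType d2) (R : realType).
Local Open Scope ereal_scope.

Variables (m1 : {sigma_finite_measure set T1 -> \bar R})
  (m2 : {sigma_finite_measure set T2 -> \bar R}).
Variables (P : set (T1 * T2)) (mP : measurable P).

Lemma product_measureE1 :
  (m1 \x m2) P = \int[m1]_x m2 [set y | P (x, y)].
Proof.
rewrite /product_measure1; apply: eq_integral => x _ /=.
by congr (m2 _); apply/seteqP; split=> y /=; rewrite /xsection /= ?inE.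
Qed.

Lemma product_measureE2 :
  (m1 \x m2) P = \int[m2]_y m1 [set x | P (x, y)].
Proof.
transitivity (\int[m1 \x m2]_z (\1_P z)%:E).
  by rewrite integral_indic// setIT.
have := indic_fubini_tonelli m1 m2 mP.
rewrite -indic_fubini_tonelli1// => ->; rewrite indic_fubini_tonelli_GE//.
apply: eq_integral => y _ /=.
by congr (m1 _); apply/seteqP; split=> x /=; rewrite /ysection /= ?inE.
Qed.

Lemma measurable_section2 (y : T2) : measurable [set x | P (x, y)].
Proof.
rewrite (_ : mkset _ = ysection P y); first exact: measurable_ysection.
by apply/seteqP; split=> x /=; rewrite /ysection /= ?inE.
Qed.

Lemma measurable_fun_section1 :
  measurable_fun setT (fun x => m2 [set y | P (x, y)]).
Proof.
rewrite (_ : (fun _ => _) = m2 \o xsection P); first exact: measurable_fun_xsection.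
apply/funext => x /=.
by congr (m2 _); apply/seteqP; split=> y /=; rewrite /xsection /= ?inE.
Qed.

Lemma measurable_fun_section2 :
  measurable_fun setT (fun y => m1 [set x | P (x, y)]).
Proof.
rewrite (_ : (fun _ => _) = m1 \o ysection P); first exact: measurable_fun_ysection.
apply/funext => y /=.
by congr (m1 _); apply/seteqP; split=> x /=; rewrite /ysection /= ?inE.
Qed.

Lemma null_product1 : (m1 \x m2) P = 0 <-> \forall x \ae m1, m2 [set y | P (x, y)] = 0.
Proof.
by rewrite product_measureE1 ge0_integral_eq0P//; exact: measurable_fun_section1.
Qed.

Lemma null_product2 : (m1 \x m2) P = 0 <-> \forall y \ae m2, m1 [set x | P (x, y)] = 0.
Proof.
by rewrite product_measureE2 ge0_integral_eq0P//; exact: measurable_fun_section2.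
Qed.

(** Tonelli's theorem for null sets: both sides say that [P] is null for the
    product measure. *)
Lemma null_sections : (\forall x \ae m1, m2 [set y | P (x, y)] = 0) <->
  \forall y \ae m2, m1 [set x | P (x, y)] = 0.
Proof. by rewrite -null_product1 null_product2. Qed.

End null_sections.

(** * Absolutely continuous parts *)

Section absolutely_continuous_part.
Context d (T : measurableType d) (R : realType).
Local Open Scope ereal_scope.
Variable nu : {measure set T -> \bar R}.

(** Exhaustion: the supremum of [m (F `&` A)] over the [nu]-null sets [A] is
    attained, since countable unions of null sets are null, and a maximizer
    absorbs every [nu]-null set up to an [m]-null set. *)
Lemma exhaust_null_sets (m : {measure set T -> \bar R}) (F : set T) :
  measurable F -> m F < +oo ->
  exists A, [/\ measurable A, nu A = 0 &
    forall E, measurable E -> nu E = 0 -> m (F `&` (E `\` A)) = 0].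
Proof.
move=> mF Foo; pose S := [set m (F `&` A) | A in [set A | measurable A /\ nu A = 0]].
have ubF A : measurable A -> m (F `&` A) <= m F.
  by move=> mA; apply: le_measure; rewrite ?inE//; exact: measurableI.
have S0 : S (m (F `&` set0)) by exists set0.
have supF : ereal_sup S <= m F.
  by apply: ge_ereal_sup => _ [A [mA _] <-]; exact: ubF.
have sup_fin : ereal_sup S \is a fin_num.
  rewrite ge0_fin_numE ?(le_lt_trans supF)//.
  by rewrite (le_trans _ (ereal_sup_ubound S0)).
have /choice[A AS] (k : nat) : exists A, [/\ measurable A, nu A = 0 &
    ereal_sup S - (k.+1%:R^-1)%:E < m (F `&` A)].
  have [|_ [A [mA A0] <-] SA] := @ub_ereal_sup_adherent _ S k.+1%:R^-1 _ sup_fin.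
    by rewrite invr_gt0.
  by exists A.
have mUA : measurable (\bigcup_k A k).
  by apply: bigcup_measurable => k _; have [] := AS k.
have UA0 : nu (\bigcup_k A k) = 0.
  apply/negligibleP => //; apply: negligible_bigcup => k.
  by have [mAk Ak0 _] := AS k; apply/negligibleP.
have supUA : ereal_sup S <= m (F `&` \bigcup_k A k).
  apply/lee_addgt0Pr => e e0.
  have /ltr_add_invr[k] := e0; rewrite add0r => ke.
  have [mAk _ /ltW] := AS k; rewrite leeBlDr// => /le_trans; apply.
  apply: leeD; last by rewrite lee_fin ltW.
  apply: le_measure; rewrite ?inE; [exact: measurableI|exact: measurableI|].
  by apply: setIS; exact: bigcup_sup.
set U := \bigcup_k A k in mUA UA0 supUA *; exists U; split=> // E mE E0.
have mD : measurable (E `\` U) by exact: measurableD.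
have : m (F `&` (U `|` (E `\` U))) <= ereal_sup S.
  apply: ereal_sup_ubound; exists (U `|` (E `\` U)) => //; split.
    exact: measurableU.
  apply/eqP; rewrite -measure_le0.
  apply: (@le_trans _ _ (nu U + nu (E `\` U))); first exact: measureU2.
  by rewrite UA0 add0e -E0 le_measure ?inE//; exact: subDsetl.
rewrite setIUr measureU; last 3 first.
- exact: measurableI.
- exact: measurableI.
- by rewrite setIACA setDE (setIC E) [U `&` _]setIA setICr set0I setI0.
move=> /le_trans/(_ supUA); rewrite -[leRHS]adde0 leeD2lE.
  by rewrite measure_le0 => /eqP.
by rewrite ge0_fin_numE// (le_lt_trans (ubF _ _)).
Qed.

(** This plays the role of the Lebesgue decomposition: [D], the complement of
    the exhausting [nu]-null sets, is where the density of [nu] with respect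
    to [m] is positive. *)
Lemma not_singular_dominates (m : {sigma_finite_measure set T -> \bar R}) :
  ~ mutually_singular nu m ->
  exists D, [/\ measurable D, m D != 0 &
    forall E, measurable E -> nu E = 0 -> m (E `&` D) = 0].
Proof.
move=> nsing; have [F FT mF] := sigma_finiteT m.
have /choice[A PA] (j : nat) := exhaust_null_sets (mF j).1 (mF j).2.
have mUA : measurable (\bigcup_j A j).
  by apply: bigcup_measurable => j _; have [] := PA j.
exists (~` \bigcup_j A j); split; first exact: measurableC.
  apply/negP => /eqP D0; apply: nsing; exists (\bigcup_j A j); split=> //.
  apply/negligibleP => //; apply: negligible_bigcup => j.
  by have [mAj Aj0 _] := PA j; apply/negligibleP.
move=> E mE E0; apply/negligibleP; first exact/measurableI/measurableC.
apply: (@negligibleS _ _ _ _ (\bigcup_j (F j `&` (E `\` A j)))).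
  move=> x [Ex nAx]; have [j _ Fx] : (\bigcup_j F j) x by rewrite -FT.
  by exists j => //; do 2!split => //; move=> Ax; apply: nAx; exists j.
apply: negligible_bigcup => j; have [mAj _ AE] := PA j.
by apply/negligibleP; [apply: measurableI (mF j).1 _; exact: measurableD|exact: AE].
Qed.

End absolutely_continuous_part.

Lemma sigma_finite_subset_lty d (T : measurableType d) (R : realType)
    (m : {sigma_finite_measure set T -> \bar R}) (A : set T) :
  measurable A -> m A != 0%E ->
  exists C, [/\ measurable C, C `<=` A, (m C != 0)%E & (m C < +oo)%E].
Proof.
move=> mA A0; have [F FT mF] := sigma_finiteT m.
have [j Aj] : exists j, m (A `&` F j) != 0%E.
  apply: contrapT => /forallNP nA; move/eqP: A0; apply.
  rewrite -(setIT A) FT setI_bigcupr; apply/negligibleP.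
    by apply: bigcup_measurable => j _; apply: measurableI => //; exact: (mF j).1.
  apply: negligible_bigcup => j; apply/negligibleP.
    by apply: measurableI => //; exact: (mF j).1.
  by have /negP := nA j; rewrite negbK => /eqP.
exists (A `&` F j); split=> //.
  by apply: measurableI => //; exact: (mF j).1.
apply: le_lt_trans (mF j).2; apply: le_measure; rewrite ?inE//.
  by apply: measurableI => //; exact: (mF j).1.
exact: (mF j).1.
Qed.

Lemma ae_dominated d (T : measurableType d) (R : realType)
    (nu m : {measure set T -> \bar R}) (D : set T) (P : T -> Prop) :
  measurable D -> (forall E, measurable E -> nu E = 0%E -> m (E `&` D) = 0%E) ->
  (\forall s \ae nu, P s) -> \forall s \ae m, D s -> P s.
Proof.
move=> mD dom [A [mA A0 PA]]; exists (A `&` D); split; last first.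
- move=> s /= nDP; split; last by apply: contrapT => nDs; exact: nDP.
  by apply: PA => Ps; exact: nDP.
- exact: dom.
- exact: measurableI.
Qed.

(** * Topological groups and their quotients by discrete subgroups *)

Section topological_group.
Variable G : topologicalGroupType.
Local Open Scope group_scope.

Lemma lmulg_continuous (g : G) : continuous (fun x : G => g * x).
Proof.
move=> x; apply: (@continuous_comp _ _ _ (fun x : G => (g, x)) (fun p => p.1 * p.2)).
  by apply: cvg_pair => //; exact: cvg_cst.
exact: mulg_continuous.
Qed.

Lemma rmulg_continuous (g : G) : continuous (fun x : G => x * g).
Proof.
move=> x; apply: (@continuous_comp _ _ _ (fun x : G => (x, g)) (fun p => p.1 * p.2)).
  by apply: cvg_pair => //; exact: cvg_cst.
exact: mulg_continuous.
Qed.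

Lemma rmulg_open (g : G) (U : set G) : open U -> open [set x | U (x * g)].
Proof. by move/continuousP: (@rmulg_continuous g); apply. Qed.

Lemma lmulg_borel (g : G) (A : set (borel G)) :
  measurable A -> measurable [set x : borel G | A (g * (x : G))].
Proof.
by move=> mA; have := continuous_borel (@lmulg_continuous g) measurableT mA;
  rewrite setTI.
Qed.

Lemma rmulg_borel (g : G) (A : set (borel G)) :
  measurable A -> measurable [set x : borel G | A ((x : G) * g)].
Proof.
by move=> mA; have := continuous_borel (@rmulg_continuous g) measurableT mA;
  rewrite setTI.
Qed.

Lemma divg_open (g : G) (U : set G) : open U -> open [set x | U (g * x^-1)].
Proof.
have /continuousP cg : continuous (fun x : G => g * x^-1); last exact: cg.
move=> x; apply: (@continuous_comp _ _ _ (fun x : G => x^-1)).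
  exact: invg_continuous.
exact: lmulg_continuous.
Qed.

Lemma open_mulg_split (U : set G) (g h : G) : open U -> U (g * h) ->
  exists V W : set G, [/\ open V, open W, V g, W h &
    forall v w, V v -> W w -> U (v * w)].
Proof.
move=> oU Ugh; have /= : nbhs (g, h) [set p : G * G | U (p.1 * p.2)].
  by apply: (@mulg_continuous G (g, h)); exact: open_nbhs_nbhs.
case=> -[A B] /= []; rewrite !nbhsE => -[V [oV Vg] VA] [W [oW Wh] WB] AB.
exists V, W; split=> // v w /VA Av /WB Bw.
by have := AB (v, w); apply.
Qed.

End topological_group.

Section homogeneous.
Variables (G : topologicalGroupType) (Gamma : groupClosed G).
Local Open Scope group_scope.
Local Notation X := (homogeneous_space Gamma).

Definition coset_proj (g : G) : X := (\pi_X g)%qT.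

Lemma coset_projP (g h : G) : coset_proj g = coset_proj h <-> g^-1 * h \in Gamma.
Proof. by split; [move/eqmodP|move=> ?; apply/eqmodP]. Qed.

Lemma coset_proj_surj (x : X) : exists h, coset_proj h = x.
Proof. by exists (repr x); rewrite /coset_proj reprK. Qed.

Lemma gact_proj (g h : G) : gact g (coset_proj h) = coset_proj (g * h).
Proof. exact: gactE. Qed.

Lemma gact1 (x : X) : gact 1 x = x.
Proof. by have [h <-] := coset_proj_surj x; rewrite gact_proj mul1g. Qed.

Lemma gactM (g h : G) (x : X) : gact g (gact h x) = gact (g * h) x.
Proof. by have [k <-] := coset_proj_surj x; rewrite !gact_proj mulgA. Qed.

Lemma coset_proj_mulr (g c : G) : c \in Gamma -> coset_proj (g * c) = coset_proj g.
Proof. by move=> cG; apply/coset_projP; rewrite invgM -mulgA mulVg mulg1 gpredV. Qed.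

Lemma coset_proj_continuous : continuous coset_proj.
Proof. exact: pi_continuous. Qed.

Lemma coset_proj_open (U : set G) : open U -> open (coset_proj @` U).
Proof.
move=> oU; rewrite /open /= /quotient_open.
rewrite (_ : _ @^-1` _ = \bigcup_(c in [set c | c \in Gamma]) [set x | U (x * c)]).
  by apply: bigcup_open => c _; exact: rmulg_open.
apply/seteqP; split=> x /=.
  by case=> u Uu /esym/coset_projP xu; exists (x^-1 * u) => //=; rewrite mulVKg.
by case=> c cG Uxc; exists (x * c) => //; exact: coset_proj_mulr.
Qed.

Lemma coset_proj_countable_base (B : (set G)^nat) :
  countable_base B -> countable_base (fun n => coset_proj @` B n).
Proof.
move=> [oB nB]; split=> [n|x U oU Ux]; first exact: coset_proj_open.
have [h hx] := coset_proj_surj x.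
have [||n Bh BU] := nB h (coset_proj @^-1` U).
- by move/continuousP: coset_proj_continuous; apply.
- by rewrite /= hx.
- by exists n; [exists h|move=> _ [g /BU Ug <-]].
Qed.

Lemma gact_continuous : continuous (fun p : G * X => gact p.1 p.2).
Proof.
move=> -[g x] /=; have [h <-] := coset_proj_surj x.
move=> W; rewrite /= gact_proj nbhsE => -[U [oU Ugh] UW].
have [||V [V' [oV oV' Vg V'h VV]]] := @open_mulg_split _ (coset_proj @^-1` U) g h => //.
exists (V, coset_proj @` V') => /=.
  split; apply: open_nbhs_nbhs; split=> //; exact: coset_proj_open.
by move=> [v y] /= [Vv [v' V'v' <-]]; apply: UW; rewrite gact_proj; exact: VV.
Qed.

Section discrete.
Variables (B : (set G)^nat) (bB : countable_base B).
Hypothesis Gamma_discrete : discrete_subset [set g : G | g \in Gamma].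

(** If [x^-1 y] stays in a neighbourhood of 1 that meets [Gamma] only in 1,
    then [x] and [y] lie in the same coset only when they are equal. *)
Lemma coset_proj_locally_injective (g : G) :
  exists n, B n g /\ {in B n &, injective coset_proj}.
Proof.
have [_ [V + VG]] : isolated [set g : G | g \in Gamma] 1.
  by apply: Gamma_discrete; exact: gpred1.
rewrite nbhsE => -[U [oU U1] UV].
have [||W [W' [oW oW' Wg W'g WW]]] := @open_mulg_split _ U g^-1 g => //.
  by rewrite mulVg.
have [||n Bg BWW] := bB.2 g ([set x | W x^-1] `&` W').
  by apply: openI => //; move/continuousP: (@invg_continuous G); apply.
  by [].
exists n; split=> // x y; rewrite !inE => /BWW[/= Wx _] /BWW[_ W'y] /coset_projP xyG.
(* [W] is a neighbourhood of [g^-1] and [W'] one of [g], with [W W'] in [U] *)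
have : (V `&` [set g : G | g \in Gamma]) (x^-1 * y) by split=> //; apply/UV/WW.
by rewrite VG => /= /(congr1 (fun z => x * z)); rewrite mulVKg mulg1.
Qed.

(** Each point of a discrete set is the only one in some basic open set, whose
    index determines it. *)
Lemma discrete_countable : countable [set g : G | g \in Gamma].
Proof.
have /choice[f fP] (c : G) : exists n, c \in Gamma ->
    B n c /\ forall c', c' \in Gamma -> B n c' -> c' = c.
  have [cG|] := boolP (c \in Gamma); last by exists 0%N.
  have [_ [V + VG]] := Gamma_discrete cG.
  rewrite nbhsE => -[U [oU Uc] UV]; have [n Bc BU] := bB.2 _ _ oU Uc.
  exists n => _; split=> // c' c'G /BU/UV Vc'.
  by have : (V `&` [set g : G | g \in Gamma]) c' by []; rewrite VG.
apply/countable_injP; exists f => c c'; rewrite !inE /= => cG c'G fcc'.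
have [Bc uc] := fP c cG; have [Bc' uc'] := fP c' c'G.
by apply: uc' => //; rewrite -fcc'.
Qed.

(** On a basic open set where the projection is injective, taking images
    commutes with relative complements, so the sets whose part in it has a
    Borel image form a sigma-algebra; it contains the open sets because the
    projection is open.  Countably many such basic sets cover the group. *)
Lemma coset_proj_borel (A : set (borel G)) :
  measurable A -> measurable (coset_proj @` A : set (borel X)).
Proof.
move=> mA.
pose inj n := {in B n &, injective coset_proj}.
have -> : coset_proj @` A = \bigcup_(n in inj) (coset_proj @` (A `&` B n)).
  apply/seteqP; split=> [_ [g Ag <-]|_ [n _ [g [Ag _] <-]]]; last by exists g.
  by have [n [Bg injn]] := coset_proj_locally_injective g; exists n => //; exists g.
apply: bigcup_measurable => n injn.
pose S := [set E : set G | measurable (coset_proj @` (E `&` B n) : set (borel X))].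
suff : <<s @open G >> `<=` S by move/(_ A mA).
apply: smallest_sub => [|U oU]; last first.
  by apply: open_borel; apply/coset_proj_open/openI => //; exact: bB.1.
split=> [|E SE|E SE]; rewrite /S /=.
- by rewrite set0I image_set0.
- rewrite (_ : _ @` _ = (coset_proj @` B n) `\` (coset_proj @` (E `&` B n))).
    apply: measurableD => //; apply: open_borel; apply: coset_proj_open; exact: bB.1.
  apply/seteqP; split=> y; last first.
    case=> -[g Bg <-] nEg; exists g => //; split=> //; split=> // Eg.
    by apply: nEg; exists g.
  case=> g [[_ nEg] Bg] <-; split; first by exists g.
  by move=> [h [Eh Bh] hg]; apply: nEg; rewrite -(injn h g) ?inE.
- rewrite setI_bigcupl image_bigcup; apply: bigcup_measurable => i _; exact: SE.
Qed.

End discrete.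
End homogeneous.
Arguments coset_proj {G} Gamma g.

(** * Convolution powers *)

Section convolution_powers.
Variables (R : realType) (G : topologicalGroupType) (B : (set G)^nat).
Hypothesis bB : countable_base B.
Variable mu : probability (borel G) R.
Local Open Scope ereal_scope.

Lemma mulg_borel : measurable_fun setT
  (fun p : borel G * borel G => ((p.1 : G) * (p.2 : G))%g : borel G).
Proof. by apply: (continuous_borel2 bB bB); exact: mulg_continuous. Qed.

Lemma mulg_preimage_borel (A : set (borel G)) : measurable A ->
  measurable [set p : borel G * borel G | A ((p.1 : G) * (p.2 : G))%g].
Proof. by move=> mA; have := mulg_borel measurableT mA; rewrite setTI. Qed.

(** [conv_pow] is a bare set function; representing it by a probability gives
    access to integration against it. *)
Lemma conv_pow_probability (n : nat) :
  exists nu : probability (borel G) R, conv_pow mu n = nu.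
Proof.
elim: n => [|n [nu nuE]]; first by exists (\d_(1%g : borel G))%R.
pose f : {mfun (borel G * borel G)%type >-> borel G} :=
  HB.pack (fun p : borel G * borel G => ((p.1 : G) * (p.2 : G))%g : borel G)
    (isMeasurableFun.Build _ _ _ _ _ mulg_borel).
exists (distribution (mu \x nu) f).
by rewrite /conv_pow iterS -/(conv_pow mu n) nuE.
Qed.

Variable nu : nat -> probability (borel G) R.
Hypothesis nuE : forall n, conv_pow mu n = nu n.

Lemma conv_powS_probability (n : nat) (A : set (borel G)) :
  nu n.+1 A = (mu \x nu n) [set p | A ((p.1 : G) * (p.2 : G))%g].
Proof. by rewrite -nuE /conv_pow iterS -/(conv_pow mu n) nuE. Qed.

Lemma integral_conv_pow0 (f : borel G -> \bar R) :
  measurable_fun setT f -> \int[nu 0%N]_x f x = f 1%g.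
Proof.
move=> mf; have nu0 : nu 0%N = (\d_(1%g : borel G))%R :> (set (borel G) -> \bar R).
  by rewrite -nuE.
rewrite (eq_measure_integral (\d_(1%g : borel G))%R); last first.
  by move=> C _ _; exact: (congr1 (fun m => m C) nu0).
by rewrite integral_dirac// diracT mul1e.
Qed.

(** The recursion defining [conv_pow] adds a factor on the left, so this
    identity amounts to associativity of the product in the group. *)
Lemma conv_powD (k l : nat) (A : set (borel G)) : measurable A ->
  nu (k + l)%N A = (nu k \x nu l) [set p | A ((p.1 : G) * (p.2 : G))%g].
Proof.
elim: k A => [|k IH] A mA.
  rewrite product_measureE1.
  rewrite integral_conv_pow0.
    by congr (nu _ _); apply/seteqP; split=> g /=; rewrite mul1g.
  exact: (measurable_fun_section1 (nu l) (mulg_preimage_borel mA)).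
rewrite addSn conv_powS_probability product_measureE1.
rewrite product_measureE1.
pose h u := nu l [set t | A ((u : G) * (t : G))%g].
have mh : measurable_fun [set: borel G] h.
  exact: (measurable_fun_section1 (nu l) (mulg_preimage_borel mA)).
rewrite [RHS](eq_measure_integral (pushforward (mu \x nu k)
  (fun p : borel G * borel G => ((p.1 : G) * (p.2 : G))%g : borel G))).
- exact: mulg_borel.
2: by move=> ? C _ _; exact: conv_powS_probability.
move=> mf; rewrite ge0_integral_pushforward//.
rewrite preimage_setT fubini_tonelli1//; last first.
  by apply: measurableT_comp => //; exact: mulg_borel.
apply: eq_integral => r _; rewrite /fubini_F /=.
rewrite IH; last exact: lmulg_borel.
rewrite product_measureE1.
apply: eq_integral => s _ /=; congr (nu _ _); apply/seteqP.
by split=> t /=; rewrite mulgA.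
Qed.

End convolution_powers.

(** * Marginals and hitting probabilities of the walk *)

Section marginals.
Variables (R : realType) (G : topologicalGroupType) (B : (set G)^nat).
Hypothesis bB : countable_base B.
Variables (Gamma : groupClosed G) (mu : probability (borel G) R).
Local Notation X := (homogeneous_space Gamma).
Local Open Scope ereal_scope.

Lemma gact_preimage_borel (A : set (borel X)) : measurable A ->
  measurable [set p : borel G * borel X | A (gact p.1 p.2)].
Proof.
move=> mA; have mgact := continuous_borel2 bB (coset_proj_countable_base Gamma bB)
  (@gact_continuous G Gamma).
by have := mgact measurableT _ mA; rewrite setTI.
Qed.

Lemma orbit_preimage_borel (x : X) (A : set (borel X)) : measurable A ->
  measurable [set g : borel G | A (gact g x)].
Proof. by move=> mA; exact: (measurable_section2 (gact_preimage_borel mA)). Qed.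

Lemma rw_kernelE (y : borel X) (A : set (borel X)) : measurable A ->
  rw_kernel mu y A = mu [set g | A (gact g y)].
Proof.
move=> mA; rewrite /rw_kernel /conv_act /pushforward product_measureE1.
transitivity (\int[mu]_g (\1_[set g : borel G | A (gact g y)] g)%:E); last first.
  by rewrite integral_indic ?setIT//; exact: orbit_preimage_borel.
apply: eq_integral => g _; rewrite /= indicE.
by congr (_%:R%:E); apply/idP/idP; rewrite !inE.
Qed.

Variable nu : nat -> probability (borel G) R.
Hypothesis nuE : forall n, conv_pow mu n = nu n.
Variable Pr : borel X -> probability (path_space (borel X)) R.
Hypothesis Pr_law : forall x, markov_chain_law (rw_kernel mu) x (Pr x).

Lemma coordinate_measurable (n : nat) :
  measurable_fun setT (fun w : path_space (borel X) => (w : nat -> borel X) n).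
Proof.
move=> _ A mA; rewrite setTI; apply: sub_sigma_algebra.
by exists n, A; split.
Qed.

Lemma coordinate_set_measurable (n : nat) (A : set (borel X)) : measurable A ->
  measurable ([set w : nat -> borel X | A (w n)] : set (path_space (borel X))).
Proof.
by move=> mA; have := coordinate_measurable n measurableT mA; rewrite setTI.
Qed.

(** By the Markov property each step adds an independent increment on the left,
    which matches the recursion of [conv_pow] after an exchange of the two
    integrals. *)
Lemma marginalE (x : X) (n : nat) (A : set (borel X)) : measurable A ->
  Pr x [set w : nat -> borel X | A (w n)] = nu n [set g | A (gact g x)].
Proof.
have [law0 lawS] := Pr_law x.
elim: n A => [|n IH] A mA.
  rewrite law0// -nuE /conv_pow /= /dirac !indicE.
  rewrite (_ : (x \in A) = ((1%g : G) \in [set g : G | A (gact g x)]))//.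
  by apply/idP/idP; rewrite !inE /= gact1.
(* a past without any constraint: only the current position matters *)
have := lawS n (fun=> setT) A (fun=> measurableT) mA => /=.
rewrite (_ : mkset _ = setT); last by apply/seteqP; split.
rewrite setTI => ->.
pose h (y : borel X) := mu [set g | A (gact g y)].
have mh : measurable_fun setT h.
  exact: (measurable_fun_section2 mu (gact_preimage_borel mA)).
have mx : measurable_fun setT (fun g : borel G => gact g x : borel X).
  by move=> _ C mC; rewrite setTI; exact: orbit_preimage_borel.
transitivity (\int[Pr x]_w h ((w : nat -> borel X) n)).
  by apply: eq_integral => w _; exact: rw_kernelE.
transitivity (\int[pushforward (Pr x)
    (fun w : path_space (borel X) => (w : nat -> borel X) n)]_y h y).
  rewrite ge0_integral_pushforward//. exact: coordinate_measurable.
transitivity (\int[pushforward (nu n) (fun g : borel G => gact g x : borel X)]_y h y).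
  apply: eq_measure_integral; first exact: coordinate_measurable.
  by move=> ? C mC _; exact: IH.
rewrite ge0_integral_pushforward// (conv_powS_probability nuE) product_measureE2.
  apply: eq_integral => g _; rewrite /= /h; congr (mu _); apply/seteqP.
  by split=> r /=; rewrite gactM.
exact: (mulg_preimage_borel bB (orbit_preimage_borel x mA)).
Qed.

Lemma hitting_prob_gt0 (x : X) (A : set (borel X)) : measurable A ->
  0 < hitting_prob Pr x A <->
  exists2 n, (1 <= n)%N & nu n [set g | A (gact g x)] != 0.
Proof.
move=> mA; rewrite lt0e measure_ge0 andbT.
pose C n := [set w : nat -> borel X | A (w n)] : set (path_space (borel X)).
have mC n : measurable (C n) by exact: coordinate_set_measurable.
have hitE : [set w : nat -> borel X | exists2 n, (1 <= n)%N & A (w n)] =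
    \bigcup_n C n.+1.
  apply/seteqP; split=> w /=; last by case=> n _ ?; exists n.+1.
  by case=> -[|n]// _ ?; exists n.
have mhit : measurable (\bigcup_n C n.+1) by apply: bigcup_measurable.
split.
  apply: contra_neqP => /forall2NP nA; rewrite /hitting_prob hitE.
  apply/negligibleP => //; apply: negligible_bigcup => n.
  apply/negligibleP => //; rewrite [LHS](marginalE x n.+1 mA).
  by have [//|/negP] := nA n.+1; rewrite negbK => /eqP.
case=> -[|n]// _; apply: contra_neq; rewrite /hitting_prob hitE => hit0.
apply/eqP; rewrite -(marginalE x n.+1 mA) -measure_le0 -hit0 le_measure ?inE//.
  exact: mC.
by move=> w Aw; exists n.
Qed.

End marginals.

(** * Haar measure: Steinhaus' argument and domination on an open set *)

Section haar_translation.
Variables (R : realType) (G : topologicalGroupType).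
Local Open Scope group_scope.
Local Open Scope ereal_scope.

(** Pick an open [V] around [C] of almost the same measure, and a compact [K]
    inside [V] of almost the measure of [V].  For [w] close to 1 the set
    [w^-1 K] is still in [V], so [E = C `&` K] and [w^-1 E] are two subsets
    of [V], each with more than half of its measure: they must overlap. *)
Lemma steinhaus (m : {measure set (borel G) -> \bar R}) (C : set (borel G)) :
  hausdorff_space G -> left_haar m ->
  measurable C -> m C != 0 -> m C < +oo ->
  exists W : set G, [/\ open W, W 1%g &
    forall w, W w -> m [set x | C x /\ C ((w : G) * (x : G))%g] != 0].
Proof.
move=> Ghaus [[_ outer inner] _ mleft] mC C0 Coo.
have Cfin : m C \is a fin_num by rewrite ge0_fin_numE.
have [a a0 aE] : exists2 a : R, (0 < a)%R & m C = a%:E.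
  exists (fine (m C)); last by rewrite fineK.
  by rewrite -lte_fin fineK// lt0e C0 measure_ge0.
have [V [oO CO Olt]] : exists V : set G, [/\ open V, C `<=` V & m V < (a + a / 4)%:E].
  have := @lb_ereal_inf_adherent _ [set m U | U in [set U : set G | open U /\ C `<=` U]]
    (a / 4)%R.
  rewrite -outer// => /(_ _ Cfin)[|_ [V [oO CO] <-]]; first by rewrite divr_gt0.
  by rewrite aE -EFinD; exists V.
have mO : measurable (V : set (borel G)) by exact: open_borel.
have Ofin : m V \is a fin_num by rewrite ge0_fin_numE// (lt_le_trans Olt)// leey.
have [K [cK KO Klt]] : exists K : set G,
    [/\ compact K, K `<=` V & m V < m K + (a / 8)%:E].
  have := @ub_ereal_sup_adherent _
    [set m K | K in [set K : set G | compact K /\ K `<=` V]] (a / 8)%R.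
  rewrite -inner// => /(_ _ Ofin)[|_ [K [cK KO] <-]]; first by rewrite divr_gt0.
  by rewrite lteBlDr// => ?; exists K.
have mK : measurable (K : set (borel G)) by apply: closed_borel; exact: compact_closed.
have : nbhs (1%g : G) [set w : G | K `<=` [set x : G | V (w^-1 * x)%g]].
  move/compact_near_coveringP: cK => /(_ _ (nbhs (1%g : G)) (fun w x => V (w^-1 * x)%g)).
  apply=> x Kx.
  have cf : continuous (fun p : G * G => (p.2^-1 * p.1)%g).
    move=> p; apply: (@continuous_comp _ _ _ (fun p : G * G => (p.2^-1, p.1)%g)
      (fun q : G * G => (q.1 * q.2)%g)); last exact: mulg_continuous.
    apply: cvg_pair; last exact: cvg_fst.
    by apply: continuous_comp; [exact: cvg_snd|exact: invg_continuous].
  apply: (cf (x, 1%g)); rewrite /= invg1 mul1g.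
  by apply: open_nbhs_nbhs; split=> //; exact: KO.
rewrite nbhsE => -[W [oW W1] WKO].
exists W; split=> // w Ww.
pose E := C `&` K; pose E' := [set x : borel G | E ((w : G) * (x : G))%g].
have mE : measurable E by exact: measurableI.
have mE' : measurable E' by exact: lmulg_borel.
have E'E : m E' = m E.
  rewrite -(mleft w^-1%g E mE); congr (m _); apply/seteqP; split=> x /=.
    by move=> Ewx; exists (w * x)%g; rewrite ?mulKg.
  by case=> y Ey <-; rewrite /E' /= mulVKg.
have EO : E `<=` V by move=> x [_ /KO].
have E'V : E' `<=` V.
  by move=> x [_ /= Kwx]; have /= := WKO _ Ww _ Kwx; rewrite mulKg.
apply/negP => /eqP null0.
have fin (S : set (borel G)) : measurable S -> S `<=` V ->
    exists2 r : R, (0 <= r)%R & m S = r%:E.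
  move=> mS SO; exists (fine (m S)); first exact: fine_ge0.
  rewrite fineK// ge0_fin_numE//.
  apply: (@le_lt_trans _ _ (m V)); last by rewrite -ge0_fin_numE.
  by apply: le_measure; rewrite ?inE.
have [e e0 eE] := fin E mE EO; have [k k0 kE] := fin K mK KO.
have [v v0 vE] := fin V mO (fun x Vx => Vx).
have [d d0 dE] := fin (V `\` K) (measurableD mO mK) (@subDsetl _ (V : set (borel G)) K).
have [c c0 cE] := fin (C `\` K) (measurableD mC mK) (subset_trans (@subDsetl _ C K) CO).
have cd : (c <= d)%R.
  rewrite -lee_fin -cE -dE; apply: le_measure; rewrite ?inE.
  - exact: measurableD.
  - exact: measurableD.
  - exact: setSD.
have cea : (a = c + e)%R.
  by apply: EFin_inj; rewrite EFinD -cE -eE -aE (measureDI m mC mK).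
have dko : (v = d + k)%R.
  apply: EFin_inj; rewrite EFinD -dE -kE -vE (measureDI m mO mK).
  by rewrite (setIidr KO).
have eeo : (e + e <= v)%R.
  rewrite -lee_fin EFinD -vE -{1}eE.
  have -> : e%:E = m (E' `\` E).
    rewrite -eE -E'E (measureDI m mE' mE).
    rewrite [X in _ + X](_ : _ = 0) ?adde0//.
    apply: subset_measure0 null0; first exact: measurableI.
      by apply: measurableI => //; exact: lmulg_borel.
    by move=> x [[Cwx _] [Cx _]].
  rewrite -measureU//; last 2 first.
  - exact: measurableD.
  - by rewrite setDE setIC -setIA setICl setI0.
  apply: le_measure; rewrite ?inE//; first exact/measurableU/measurableD.
  by move=> x [/EO|[/E'V]].
(* with [m C = a]: [m V < 5 a / 4] and [m (V `\` K) < a / 8], so that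
   [m E > 7 a / 8], whereas two disjoint copies of [E] would fit in [V] *)
move: Olt Klt; rewrite vE kE -EFinD !lte_fin => Olt Klt.
move: a0 cd cea dko eeo Olt Klt; clear; lra.
Qed.

End haar_translation.

Section haar_domination.
Variables (R : realType) (G : topologicalGroupType) (B : (set G)^nat).
Hypotheses (bB : countable_base B) (Ghaus : hausdorff_space G).
Local Open Scope ereal_scope.

Lemma left_haar_lmul (m : {measure set (borel G) -> \bar R}) (g : G)
    (A : set (borel G)) : left_haar m -> measurable A ->
  m [set x | A ((g : G) * (x : G))%g] = m A.
Proof.
case=> _ _ mleft mA; rewrite -(mleft g^-1%g A mA); congr (m _).
apply/seteqP; split=> x /=; first by move=> Agx; exists (g * x)%g; rewrite ?mulKg.
by case=> y Ay <-; rewrite mulVKg.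
Qed.

Variable m : {sigma_finite_measure set (borel G) -> \bar R}.
Hypothesis mhaar : left_haar m.

(** Where [D] carries an absolutely continuous part of [nu], the convolution
    square of [nu] has a density that is positive at [r] as soon as
    [F r = m {s | s \in D, s^-1 r \in D}] is positive.  The integral of [F]
    is [m D] squared, so [F r0 > 0] for some [r0]; and [F] stays positive near
    [r0], because with [C] inside [{s | s \in D, s^-1 r0 \in D}] and
    [w = r0 r^-1], a point [x] of [C] with [w x] in [C] satisfies [x \in D]
    and [x^-1 r = (w x)^-1 r0 \in D]. *)
Lemma dominated_on_open (nu : probability (borel G) R) (D : set (borel G)) :
  measurable D -> m D != 0 ->
  (forall E : set (borel G), measurable E -> nu E = 0 -> m (E `&` D) = 0) ->
  exists U : set G, [/\ open U, U !=set0 &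
    forall E : set (borel G), measurable E ->
      (nu \x nu) [set p | E ((p.1 : G) * (p.2 : G))%g] = 0 ->
      m (E `&` (U : set (borel G))) = 0].
Proof.
move=> mD D0 dom.
have mdiv : measurable_fun setT
    (fun p : borel G * borel G => ((p.1 : G)^-1 * (p.2 : G))%g : borel G).
  apply: (continuous_borel2 bB bB) => p.
  apply: (@continuous_comp _ _ _ (fun p : G * G => (p.1^-1, p.2)%g)
    (fun q : G * G => (q.1 * q.2)%g)); last exact: mulg_continuous.
  apply: cvg_pair; last exact: cvg_snd.
  by apply: continuous_comp; [exact: cvg_fst|exact: invg_continuous].
have mdivD : measurable [set p : borel G * borel G | D ((p.1 : G)^-1 * (p.2 : G))%g].
  by have := mdiv measurableT _ mD; rewrite setTI.
have mfstD : measurable [set p : borel G * borel G | D p.1].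
  by have := @measurable_fst _ _ (borel G) (borel G) measurableT _ mD; rewrite setTI.
have mDD := measurableI _ _ mfstD mdivD.
have mlD s (A : set (borel G)) :
    measurable A -> m [set r | A ((s : G)^-1 * (r : G))%g] = m A.
  exact: left_haar_lmul.
have [r0 Cr0] : exists r0 : G, m [set s | D s /\ D ((s : G)^-1 * r0)%g] != 0.
  apply: contrapT => /forallNP nr0; move/eqP: (D0); apply.
  have : \forall s \ae m, m [set r | D s /\ D ((s : G)^-1 * (r : G))%g] = 0.
    apply/(null_sections m m mDD)/aeW => r.
    by have /negP := nr0 r; rewrite negbK => /eqP.
  case=> N [mN N0 DN]; apply: subset_measure0 N0 => //.
  move=> s Ds; apply: DN => /= sD0; move/eqP: D0; apply; rewrite -sD0.
  by rewrite -(mlD s D mD); congr (m _); apply/seteqP; split=> r //= [].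
have mCr0 : measurable [set s : borel G | D s /\ D ((s : G)^-1 * r0)%g].
  exact: (measurable_section2 mDD).
have [C [mC CD C0 Coo]] := sigma_finite_subset_lty mCr0 Cr0.
have [W [oW W1 CW]] := steinhaus Ghaus mhaar mC C0 Coo.
have oU : open [set r : G | W (r0 * r^-1)%g] by exact: divg_open.
exists [set r | W (r0 * r^-1)%g]; split=> //.
  by exists r0; rewrite /= mulgV.
move=> E mE EE0; have mU := open_borel oU.
have mfstE : measurable [set p : borel G * borel G | E p.2].
  by have := @measurable_snd _ _ (borel G) (borel G) measurableT _ mE; rewrite setTI.
have mDDE := measurableI _ _ mDD mfstE.
have /(ae_dominated mD dom) sE := (null_product1 nu nu (mulg_preimage_borel bB mE)).1 EE0.
have : \forall s \ae m, m [set r | (D s /\ D ((s : G)^-1 * (r : G))%g) /\ E r] = 0.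
  apply: filterS sE => s sE; have [Ds|nDs] := pselect (D s); last first.
    by rewrite -(measure0 m); congr (m _); apply/seteqP; split=> r //= [[]].
  have mEs : measurable [set t : borel G | E ((s : G) * (t : G))%g] by exact: lmulg_borel.
  rewrite -[RHS](dom _ mEs (sE Ds)) -[RHS](mlD s _ (measurableI _ _ mEs mD)).
  by congr (m _); apply/seteqP; split=> r /=; rewrite mulVKg; [case=> -[]|case].
move/(null_sections m m mDDE) => [N [mN N0 EN]].
apply: subset_measure0 N0 => //; first exact: measurableI.
move=> r [Er Wr]; apply: EN => /= r0'.
move/eqP: (CW _ Wr); apply; apply: subset_measure0 r0'.
- by apply: measurableI => //; exact: lmulg_borel.
- exact: (measurable_section2 mDDE).
- move=> x [Cx Cwx]; have [Dx _] := CD _ Cx; have [_ /=] := CD _ Cwx.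
  by rewrite invgM invgM invgK -!mulgA mulVg mulg1.
Qed.
End haar_domination.

(** * Quasi-invariance and the Haar measure class of the quotient *)

Section quasi_invariant_measures.
Variables (R : realType) (G : topologicalGroupType) (B : (set G)^nat).
Hypothesis bB : countable_base B.
Variable Gamma : groupClosed G.
Local Notation X := (homogeneous_space Gamma).
Local Open Scope ereal_scope.

Lemma modular_rmul (m : {measure set (borel G) -> \bar R}) (Delta : G -> R)
    (g : G) (A : set (borel G)) : modular_character m Delta -> measurable A ->
  m [set x | A ((x : G) * g)%g] = (Delta g^-1%g)%:E * m A.
Proof.
case=> _ mright mA; rewrite -(mright g^-1%g A mA); congr (m _).
apply/seteqP; split=> x /=; first by move=> Axg; exists (x * g)%g; rewrite ?mulgK.
by case=> y Ay <-; rewrite mulgVK.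
Qed.

Lemma modular_rmul_eq0 (m : {measure set (borel G) -> \bar R}) (Delta : G -> R)
    (g : G) (A : set (borel G)) : modular_character m Delta -> measurable A ->
  m [set x | A ((x : G) * g)%g] = 0 <-> m A = 0.
Proof.
move=> mD mA; rewrite (modular_rmul g mD mA); have [[D0 _ _] _] := mD.
split; last by move=> ->; rewrite mule0.
by move/eqP; rewrite mule_eq0 eqe gt_eqF//= => /eqP.
Qed.

Lemma chi_haar_gact_eq0 (mX : {measure set (borel X) -> \bar R}) (chi : G -> R)
    (g : G) (A : set (borel X)) : continuous_character chi -> chi_haar chi mX ->
  measurable A -> mX [set x | A (gact g x)] = 0 <-> mX A = 0.
Proof.
move=> [chi0 _ _] [_ _ mXg] mA.
rewrite (_ : mX [set x | A (gact g x)] = (chi g)%:E * mX A); last exact: mXg.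
split; last by move=> ->; rewrite mule0.
by move/eqP; rewrite mule_eq0 eqe gt_eqF//= => /eqP.
Qed.

Variables (mG : {sigma_finite_measure set (borel G) -> \bar R}) (Delta : G -> R).
Variables (mX : {sigma_finite_measure set (borel X) -> \bar R}) (chi : G -> R).
Hypotheses (mG_haar : left_haar mG) (Delta_modular : modular_character mG Delta).
Hypotheses (chi_char : continuous_character chi) (mX_haar : chi_haar chi mX).

Lemma coset_proj_preimage_borel (A : set (borel X)) : measurable A ->
  measurable [set g : borel G | A (coset_proj Gamma g)].
Proof.
by move=> mA; have := continuous_borel (@coset_proj_continuous _ Gamma) measurableT mA;
  rewrite setTI.
Qed.

(** Both measures are quasi-invariant, so in the set of pairs [(g, x)] with
    [g x \in A] the sections at fixed [g] are translates of [A] and those at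
    fixed [x = h Gamma] are right translates of the preimage of [A]: in each
    direction one null section makes all of them null. *)
Lemma null_proj_preimage (A : set (borel X)) : measurable A ->
  mX A = 0 <-> mG [set g | A (coset_proj Gamma g)] = 0.
Proof.
move=> mA; have mP := gact_preimage_borel bB mA.
have mA' := coset_proj_preimage_borel mA.
have secX h : [set g : borel G | A (gact g (coset_proj Gamma h))] =
    [set g | [set k : borel G | A (coset_proj Gamma k)] ((g : G) * h)%g].
  by apply/seteqP; split=> g /=; rewrite gact_proj.
split=> A0.
  have : \forall g \ae mG, mX [set x | A (gact g x)] = 0.
    by apply: aeW => g; apply/(chi_haar_gact_eq0 g chi_char mX_haar mA).
  move/(null_sections mG mX mP)/ae_exists; case: mX_haar => _ mXT _.
  move/(_ mXT) => [x]; have [h <-] := coset_proj_surj x.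
  by rewrite /= secX => /(modular_rmul_eq0 h Delta_modular mA').
have : \forall x \ae mX, mG [set g | A (gact g x)] = 0.
  apply: aeW => x; have [h <-] := coset_proj_surj x; rewrite secX.
  exact/(modular_rmul_eq0 h Delta_modular mA').
move/(null_sections mG mX mP)/ae_exists; case: mG_haar => _ mGT _.
by move/(_ mGT) => [g /=] /(chi_haar_gact_eq0 g chi_char mX_haar mA).
Qed.

(** The preimage of the image of [N] is the union of the countably many null
    sets [N c], with [c] in [Gamma]. *)
Lemma null_proj_image (N : set (borel G)) :
  discrete_subset [set g : G | g \in Gamma] ->
  measurable N -> mG N = 0 -> mX (coset_proj Gamma @` N) = 0.
Proof.
move=> Gamma_discrete mN N0.
apply/(null_proj_preimage (coset_proj_borel bB Gamma_discrete mN)).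
have /countable_injP[f finj] := discrete_countable bB Gamma_discrete.
apply/negligibleP.
  exact: coset_proj_preimage_borel (coset_proj_borel bB Gamma_discrete mN).
(* [f] numbers the elements of [Gamma]; [F n] is the translate of [N] by the
   inverse of the element numbered [n], and is empty if there is none *)
pose F n : set (borel G) := [set x : G | exists2 c, c \in Gamma /\ f c = n & N (x * c)%g].
apply: (@negligibleS _ _ _ _ (\bigcup_n F n)).
  move=> x [g Ng /esym/coset_projP xg]; exists (f (x^-1 * g)%g) => //.
  by exists (x^-1 * g)%g => //; rewrite mulVKg.
apply: negligible_bigcup => n.
have [[c [cG fc]]|nc] := pselect (exists c, c \in Gamma /\ f c = n); last first.
  apply: negligibleS (negligible_set0 _) => x [c cn _].
  by apply: nc; exists c.
apply: (@negligibleS _ _ _ _ [set x : borel G | N ((x : G) * c)%g]).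
  move=> x [c' [c'G fc'] Nx] /=; rewrite (finj c c') ?inE// fc fc'.
  by [].
apply/negligibleP; first exact: rmulg_borel.
exact/(modular_rmul_eq0 c Delta_modular mN).
Qed.

End quasi_invariant_measures.

(** * Null sets of irreducibility measures *)

Section irreducible_walks.
Variables (R : realType) (G : topologicalGroupType) (B : (set G)^nat).
Hypothesis bB : countable_base B.
Variables (Gamma : groupClosed G) (mu : probability (borel G) R).
Local Notation X := (homogeneous_space Gamma).
Local Open Scope ereal_scope.
Variable nu : nat -> probability (borel G) R.
Hypothesis nuE : forall n, conv_pow mu n = nu n.
Variable Pr : borel X -> probability (path_space (borel X)) R.
Hypothesis Pr_law : forall x, markov_chain_law (rw_kernel mu) x (Pr x).
Variables (mX : {sigma_finite_measure set (borel X) -> \bar R}) (chi : G -> R).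
Hypotheses (chi_char : continuous_character chi) (mX_haar : chi_haar chi mX).

(** Almost every starting point avoids an [mX]-null set forever, and one such
    point is enough to refute positivity of an irreducibility measure. *)
Lemma irreducibility_measure_null phi (A : set (borel X)) :
  irreducibility_measure Pr phi -> measurable A -> mX A = 0 -> phi A = 0.
Proof.
move=> irr mA A0; have mP := gact_preimage_borel bB mA.
have : \forall x \ae mX, forall n, nu n [set g | A (gact g x)] = 0.
  apply/ae_foralln => n; apply/(null_sections (nu n) mX mP)/aeW => g.
  exact/(chi_haar_gact_eq0 g chi_char mX_haar mA).
case: mX_haar => _ mXT _ /(ae_exists mXT)[x x0].
apply: contrapT => /eqP phiA.
have /(hitting_prob_gt0 bB nuE Pr_law) : 0 < hitting_prob Pr x A.
  by apply: irr => //; rewrite lt0e phiA measure_ge0.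
by move=> /(_ mA)[n _]; rewrite x0 eqxx.
Qed.

Variables (mG : {sigma_finite_measure set (borel G) -> \bar R}) (Delta : G -> R).
Hypotheses (mG_haar : left_haar mG) (Delta_modular : modular_character mG Delta).

(** If all convolution powers are singular, a single Haar-null set [N] carries
    all of them.  Its image in the quotient is [mX]-null, and its complement is
    never hit from the base point, so an irreducibility measure gives zero
    mass to both. *)
Lemma irreducible_spread_out :
  discrete_subset [set g : G | g \in Gamma] ->
  psi_irreducible Pr -> spread_out mu mG.
Proof.
move=> Gamma_discrete [phi [irr phiT]]; apply: contrapT => nspread.
have /choice[A PA] (n : nat) : exists A : set (borel G),
    [/\ measurable A, nu n.+1 A = 0 & mG (~` A) = 0].
  apply: contrapT => nA; apply: nspread; exists n.+1 => // -[A [mA A0 AC0]].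
  by apply: nA; exists A; split=> //; rewrite -nuE.
pose N : set (borel G) := \bigcup_n ~` A n.
have mN : measurable N.
  by apply: bigcup_measurable => n _; apply: measurableC; have [] := PA n.
have N0 : mG N = 0.
  apply/negligibleP => //; apply: negligible_bigcup => n.
  by have [mAn _ An0] := PA n; apply/negligibleP => //; exact: measurableC.
have mpN := coset_proj_borel bB Gamma_discrete mN.
have phiN : phi (coset_proj Gamma @` N) = 0.
  apply: (irreducibility_measure_null irr mpN).
  exact: (null_proj_image bB mG_haar Delta_modular chi_char mX_haar).
move/negP: phiT; apply; apply/eqP.
rewrite -(setUv (coset_proj Gamma @` N)); apply: null_set_setU => //.
  exact: measurableC.
apply: contrapT => /eqP phiC.
have : 0 < hitting_prob Pr (coset_proj Gamma 1%g) (~` (coset_proj Gamma @` N)).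
  by apply: irr; [exact: measurableC|rewrite lt0e phiC measure_ge0].
move/(hitting_prob_gt0 bB nuE Pr_law) => /(_ (measurableC mpN))[[|n]//] _.
move/negP; apply; apply/eqP; have [mAn An0 _] := PA n.
apply: subset_measure0 An0 => //.
  by apply: (orbit_preimage_borel bB); exact: measurableC.
move=> g /=; rewrite gact_proj mulg1 => gN; apply: contrapT => nAg.
by apply: gN; exists g => //; exists n.
Qed.

End irreducible_walks.

(** * Sets reached by a spread out walk *)

Section semigroup.
Variables (R : realType) (G : topologicalGroupType) (B : (set G)^nat).
Hypothesis bB : countable_base B.
Variable mu : probability (borel G) R.
Local Open Scope ereal_scope.
Variable nu : nat -> probability (borel G) R.
Hypothesis nuE : forall n, conv_pow mu n = nu n.

Lemma conv_pow1 (A : set (borel G)) : measurable A -> nu 1%N A = mu A.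
Proof.
move=> mA; rewrite (conv_powS_probability nuE) product_measureE2; last first.
  exact: (mulg_preimage_borel bB mA).
rewrite (integral_conv_pow0 nuE).
  by congr (mu _); apply/seteqP; split=> g /=; rewrite mulg1.
exact: (measurable_fun_section2 mu (mulg_preimage_borel bB mA)).
Qed.

Lemma conv_powD_gt0 (k l : nat) (A C E : set (borel G)) :
  measurable A -> measurable C -> measurable E ->
  (forall a c, A a -> C c -> E ((a : G) * (c : G))%g) ->
  nu k A != 0 -> nu l C != 0 -> nu (k + l)%N E != 0.
Proof.
move=> mA mC mE ACE A0 C0; rewrite (conv_powD bB nuE)//; apply/negP => /eqP E0.
suff : (nu k A * nu l C)%E == 0 by rewrite mule_eq0 (negbTE A0) (negbTE C0).
rewrite -(product_measure1E (nu k) (nu l) mA mC); apply/eqP.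
apply: subset_measure0 E0; first exact: measurableX.
  exact: (mulg_preimage_borel bB mE).
by move=> [a c] [/= Aa Cc]; exact: ACE.
Qed.

(** The points all of whose neighbourhoods are charged by some convolution
    power form a closed subsemigroup containing the support. *)
Lemma semigroup_charged (s : G) (V : set G) :
  closed_subsemigroup_gen (Defs.support mu) s -> open V -> V s ->
  exists2 k, (1 <= k)%N & nu k V != 0.
Proof.
pose H := [set s : G | forall V : set G, open V -> V s ->
  exists2 k, (1 <= k)%N & nu k V != 0].
suff SH : closed_subsemigroup_gen (Defs.support mu) `<=` H by move=> /SH/(_ V); apply.
apply: smallest_sub; last first.
  move=> g sg U oU Ug; exists 1%N => //; rewrite conv_pow1; last exact: open_borel.
  by rewrite gt_eqF//; exact: sg.
split.
- move=> g clg U oU Ug.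
  have [h [Hh Uh]] := clg U (open_nbhs_nbhs (conj oU Ug)).
  exact: Hh.
- move=> g h; rewrite !inE => Hg Hh U oU Ugh.
  have [A [C [oA oC Ag Ch ACU]]] := open_mulg_split oU Ugh.
  have [k k1 Ak] := Hg A oA Ag; have [l l1 Cl] := Hh C oC Ch.
  exists (k + l)%N; first by rewrite (leq_trans k1)// leq_addr.
  by apply: (conv_powD_gt0 _ _ _ ACU Ak Cl); exact: open_borel.
Qed.

(** Otherwise the basic open sets meeting [A] in a null set would cover [A]. *)
Lemma support_point (m : {measure set (borel G) -> \bar R}) (A : set (borel G)) :
  measurable A -> m A != 0 ->
  exists g : G, forall V : set G, open V -> V g -> m (A `&` (V : set (borel G))) != 0.
Proof.
move=> mA A0; apply: contrapT => /forallNP nA; move/eqP: A0; apply.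
pose I := [set n | m (A `&` (B n : set (borel G))) = 0].
apply/negligibleP => //.
apply: (@negligibleS _ _ _ _
  (\bigcup_n if n \in I then A `&` (B n : set (borel G)) else set0)).
  move=> g Ag; have /existsNP[V /not_implyP[oV /not_implyP[Vg /negP]]] := nA g.
  rewrite negbK => /eqP AV0; have [n Bg BV] := bB.2 _ _ oV Vg.
  exists n => //; rewrite mem_set//.
  apply: subset_measure0 AV0.
  - by apply: measurableI => //; exact: open_borel (bB.1 n).
  - by apply: measurableI => //; exact: open_borel.
  - by apply: setIS.
apply: negligible_bigcup => n; case: ifPn => [|_]; last exact: negligible_set0.
rewrite inE => AB0; apply/negligibleP => //.
by apply: measurableI => //; exact: open_borel (bB.1 n).
Qed.

Variables (mG : {sigma_finite_measure set (borel G) -> \bar R}) (Delta : G -> R).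
Hypotheses (mG_haar : left_haar mG) (Delta_modular : modular_character mG Delta).
Hypothesis Ghaus : hausdorff_space G.

Lemma spread_out_dominates : spread_out mu mG ->
  exists n (U : set G), [/\ open U, U !=set0 &
    forall E : set (borel G), measurable E ->
      nu n E = 0 -> mG (E `&` (U : set (borel G))) = 0].
Proof.
case=> n _; rewrite nuE => nsing.
have [D [mD D0 dom]] := not_singular_dominates nsing.
have [U [oU U0 domU]] := dominated_on_open bB Ghaus mG_haar mD D0 dom.
exists (n + n)%N, U; split=> // E mE E0; apply: domU => //.
by rewrite -(conv_powD bB nuE).
Qed.

Variable Gamma : groupClosed G.

(** [A] stands for the preimage of a subset of the quotient, and [h] for a
    representative of the starting point.  The n-th power, which dominates Haar
    measure on [U], is used after a k-th power charging the neighbourhood [Ns]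
    of [s]. *)
Lemma spread_out_charges (A : set (borel G)) (h : G) :
  spread_out mu mG -> Gamma_adapted Gamma mu ->
  measurable A -> (forall g c, c \in Gamma -> A g -> A (g * c)%g) -> mG A != 0 ->
  exists2 n, (1 <= n)%N & nu n [set g | A ((g : G) * h)%g] != 0.
Proof.
move=> /spread_out_dominates[n [U [oU [u0 Uu0] dom]]] [_ adapt] mA Asat A0.
have [g0 g0A] := support_point mA A0.
(* a point [g0] around which [A] is nowhere null is moved into [U] *)
have : [set (s * c)%g | s in closed_subsemigroup_gen (Defs.support mu) &
    c in conj_subgroup Gamma h] (u0^-1 * g0 * h^-1)%g by rewrite adapt.
case=> s Ss [_ [c cG <-] sc].
have g0E : g0 = (u0 * s * h * c)%g.
  have : (u0 * (s * (h * c * h^-1)) * h)%g = (u0 * (u0^-1 * g0 * h^-1) * h)%g.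
    by rewrite sc.
  by rewrite !mulgA mulgV mul1g !mulgVK => ->.
(* [W] leaves room to replace [s] by any [s'] with [s s'^-1] in [W] *)
have [V [W [oV oW Vu0 W1 VWU]]] : exists V W : set G,
    [/\ open V, open W, V u0, W 1%g & forall v w, V v -> W w -> U (v * w)%g].
  by apply: open_mulg_split => //; rewrite mulg1.
pose Ns : set G := [set s' | W (s * s'^-1)%g].
have oNs : open Ns by exact: divg_open.
have [k k1 Nsk] : exists2 k, (1 <= k)%N & nu k Ns != 0.
  by apply: semigroup_charged Ss oNs _; rewrite /Ns /= mulgV.
exists (n + k)%N; first by rewrite (leq_trans k1)// leq_addl.
rewrite (conv_powD bB nuE); last exact: rmulg_borel.
have mAh : measurable [set g : borel G | A ((g : G) * h)%g] by exact: rmulg_borel.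
have mP := mulg_preimage_borel bB mAh.
apply/negP => /eqP /(null_product2 (nu n) (nu k) mP) ae0.
move/negP: Nsk; apply; apply/eqP/negligibleP; first exact: open_borel.
apply: negligibleS ae0 => s' Ns' /= nus'.
pose E : set (borel G) := [set r | A (((r : G) * s') * h)%g].
have mE : measurable E by exact: (rmulg_borel s' mAh).
have := dom E mE nus'.
(* [V1 = V s h c] is a neighbourhood of [g0], and its translate by [c^-1] lies
   in [U s' h] because [V s = V (s s'^-1) s'] *)
pose V1 : set G := [set g | V (g * c^-1 * h^-1 * s^-1)%g].
have oV1 : open V1.
  have -> : V1 = [set g | V (g * (c^-1 * h^-1 * s^-1))%g].
    by apply/seteqP; split=> g; rewrite /V1 /= !mulgA.
  exact: rmulg_open.
have V1g0 : V1 g0 by rewrite /V1 /= g0E mulgK mulgK mulgK.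
move=> EU0; have /negP := g0A V1 oV1 V1g0; apply; apply/eqP.
have mEU : measurable (E `&` (U : set (borel G))).
  by apply: measurableI => //; exact: open_borel.
move: EU0 => /(modular_rmul_eq0 (c^-1 * h^-1 * s'^-1)%g Delta_modular mEU).
apply: subset_measure0.
- by apply: measurableI => //; exact: open_borel.
- exact: rmulg_borel.
move=> g [Ag V1g]; split=> /=.
  rewrite /E /= !mulgA !mulgVK.
  by apply: Asat => //; rewrite gpredV.
have -> : (g * (c^-1 * h^-1 * s'^-1) =
    (g * c^-1 * h^-1 * s^-1) * (s * s'^-1))%g by rewrite !mulgA mulgVK.
exact: VWU.
Qed.

End semigroup.

(** * Sigma-finiteness and conclusion *)

Section sigma_finiteness.
Variables (R : realType) (G : topologicalGroupType) (B : (set G)^nat).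
Hypotheses (bB : countable_base B) (Ghaus : hausdorff_space G).
Hypothesis G_sigma_compact : sigma_compact G.

Lemma radon_sigma_finite (m : {measure set (borel G) -> \bar R}) :
  radon m -> sigma_finite setT m.
Proof.
case=> mcompact _ _; have [K cK KT] := G_sigma_compact.
exists K => // n; split; last exact: mcompact.
by apply: closed_borel; exact: compact_closed.
Qed.

Variable Gamma : groupClosed G.
Hypothesis Gamma_discrete : discrete_subset [set g : G | g \in Gamma].
Local Notation X := (homogeneous_space Gamma).

Lemma radon_quotient_sigma_finite (m : {measure set (borel X) -> \bar R}) :
  radon m -> sigma_finite setT m.
Proof.
case=> mcompact _ _; have [K cK KT] := G_sigma_compact.
exists (fun n => coset_proj Gamma @` K n) => [|n].
  apply/seteqP; split=> // x _; have [h <-] := coset_proj_surj x.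
  have [n _ Kh] : (\bigcup_n K n) h by rewrite KT.
  by exists n => //; exists h.
split.
  by apply: (coset_proj_borel bB Gamma_discrete); apply: closed_borel;
    exact: compact_closed.
apply: mcompact; apply: continuous_compact => //.
exact/continuous_subspaceT/coset_proj_continuous.
Qed.

End sigma_finiteness.

Theorem proposition3p5 (R : realType) (G : topologicalGroupType)
  (G_sigma_compact : sigma_compact G)
  (G_locally_compact : locally_compact [set: G])
  (G_metrizable : metrizable R G)
  (Gamma : groupClosed G)
  (Gamma_discrete : discrete_subset [set g : G | g \in Gamma])
  (mu : probability (borel G) R)
  (Pr : borel (homogeneous_space Gamma) ->
        probability (path_space (borel (homogeneous_space Gamma))) R)
  (Pr_law : forall x, markov_chain_law (rw_kernel mu) x (Pr x))
  (mG : {measure set (borel G) -> \bar R}) (mG_haar : left_haar mG)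
  (Delta : G -> R) (Delta_modular : modular_character mG Delta)
  (chi : G -> R) (chi_ext : extends_modular_character Gamma Delta chi)
  (mX : {measure set (borel (homogeneous_space Gamma)) -> \bar R})
  (mX_haar : chi_haar chi mX) :
  (psi_irreducible Pr ->
     spread_out mu mG /\
     forall psi, maximal_irreducibility_measure Pr psi -> psi `<< mX) /\
  (spread_out mu mG -> Gamma_adapted Gamma mu ->
     psi_irreducible Pr /\
     forall psi, maximal_irreducibility_measure Pr psi ->
       mX `<< psi /\ psi `<< mX).
Proof.
have Ghaus := metrizable_hausdorff G_metrizable.
have [B bB] := metrizable_countable_base G_sigma_compact G_metrizable.
have mGfin : sigma_finite setT mG.
  by apply: (radon_sigma_finite Ghaus G_sigma_compact); case: mG_haar.
have mXfin : sigma_finite setT mX.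
  apply: (radon_quotient_sigma_finite bB Ghaus G_sigma_compact Gamma_discrete).
  by case: mX_haar.
have /choice[nu nuE] := conv_pow_probability bB mu.
have chi_char : continuous_character chi by case: chi_ext.
pose mG' : {sigma_finite_measure set (borel G) -> \bar R} := sfmeasure mGfin.
pose mX' : {sigma_finite_measure set (borel (homogeneous_space Gamma)) -> \bar R} :=
  sfmeasure mXfin.
have mG'_haar : left_haar mG' by exact: mG_haar.
have Delta'_modular : modular_character mG' Delta by exact: Delta_modular.
have mX'_haar : chi_haar chi mX' by exact: mX_haar.
have domX psi : irreducibility_measure Pr psi -> psi `<< mX.
  move=> irr; apply/null_content_dominatesP => A mA A0.
  exact: (irreducibility_measure_null bB nuE Pr_law chi_char mX'_haar irr mA A0).
split=> [irr|spread adapt].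
  split; last by move=> psi [/domX].
  exact: (irreducible_spread_out bB nuE Pr_law chi_char mX'_haar mG'_haar
    Delta'_modular Gamma_discrete irr).
have mX_irr : irreducibility_measure Pr mX'.
  move=> A mA A0 x; have [h <-] := coset_proj_surj x.
  apply/(hitting_prob_gt0 bB nuE Pr_law _ mA).
  have mA' := coset_proj_preimage_borel mA.
  have [||n n1 nuA] := spread_out_charges (A := [set g | A (coset_proj Gamma g)])
    bB nuE mG'_haar Delta'_modular Ghaus h spread adapt mA'.
  - by move=> g c cG /=; rewrite coset_proj_mulr.
  - apply: contraTneq A0 => A'0; rewrite -leNgt.
    by rewrite (null_proj_preimage bB mG'_haar Delta'_modular chi_char mX'_haar mA).2.
  exists n => //; rewrite (_ : mkset _ = [set g | A (coset_proj Gamma (g * h)%g)])//.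
  by apply/seteqP; split=> g /=; rewrite gact_proj.
split.
  by exists mX'; split=> //; case: mX_haar.
move=> psi [psi_irr psi_max]; split; last exact: domX.
exact: psi_max mX_irr.
Qed.
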